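(* Let $n,r\ge1$, $A_{-1}\in\mathbb{R}^{n\times n}$, $B\in\mathbb{R}^{n\times r}$, and let $A_2,A_3$ be $n\times n$ matrix functions on $[-1,0]$ with entries in $L_2([-1,0],\mathbb{C})$. Consider the neutral type system $$\dot z(t)=A_{-1}\dot z(t-1)+\int_{-1}^0A_2(\theta)\dot z(t+\theta)\,d\theta+\int_{-1}^0A_3(\theta)z(t+\theta)\,d\theta+Bu(t)$$ and its operator model $\dot x=\mathcal A x+\mathcal B u$ on $M_2$ described in the context. If the pair $(A_{-1},B)$ is not controllable, i.e. $\operatorname{rank}(B\ \ A_{-1}B\ \cdots\ A_{-1}^{n-1}B)<n$ (equivalently, there exist $\mu\in\sigma(A_{-1})$ and $y\in\mathbb{C}^n\setminus\{0\}$ with $A_{-1}^*y=\bar\mu y$ and $B^*y=0$), then the system is not exactly controllable at any time, i.e. $\mathcal R_T\neq\mathcal D(\mathcal A)$ for every $T>0$. (No assumption on invertibility of $A_{-1}$ is made.)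
   Context: The state space is $M_2=\mathbb{C}^n\times L_2(-1,0;\mathbb{C}^n)$. The operator $\mathcal A$ is defined by $\mathcal A(y,z(\cdot))=\big(Lz,\ \tfrac{d}{d\theta}z\big)$, where $Lz=\int_{-1}^0A_2(\theta)z'(\theta)\,d\theta+\int_{-1}^0A_3(\theta)z(\theta)\,d\theta$, on the domain $\mathcal D(\mathcal A)=\{(y,z(\cdot))\in M_2: z\in H^1(-1,0;\mathbb{C}^n),\ y=z(0)-A_{-1}z(-1)\}$; $\mathcal A$ generates a $C_0$-semigroup $e^{\mathcal At}$ on $M_2$. The control operator is $\mathcal Bu=(Bu,0)$ for $u\in\mathbb{C}^r$. The reachability set from $0$ at time $T$ is $\mathcal R_T=\{\int_0^Te^{\mathcal At}\mathcal Bu(t)\,dt: u\in L_2(0,T;\mathbb{C}^r)\}$. The system is exactly controllable at time $T$ if $\mathcal R_T=\mathcal D(\mathcal A)$ (equivalently, the set of restrictions to $[T-1,T]$ of solutions with zero initial data on $[-1,0]$, over all controls $u\in L_2(0,T;\mathbb{C}^r)$, equals $H^1(T-1,T;\mathbb{C}^n)$). *)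

(* Defs.v *)
From HB Require Import structures.
From mathcomp Require Import all_boot all_order all_algebra.
From mathcomp Require Import all_classical all_reals all_analysis.
From mathcomp Require Import complex.

Set Implicit Arguments.
Unset Strict Implicit.
Unset Printing Implicit Defensive.

Import Order.TTheory GRing.Theory Num.Theory.
Local Open Scope classical_set_scope.
Local Open Scope ring_scope.

Section NeutralDefs.
Variable R : realType.
Local Notation C := (complex R).
Local Notation mu := (@lebesgue_measure R).

Definition L2r (D : set R) (f : R -> R) : Prop :=
  measurable_fun D f /\ (\int[mu]_(x in D) ((f x) ^+ 2)%:E < +oo)%E.

Definition L2c (D : set R) (h : R -> C) : Prop :=
  L2r D (fun x => complex.Re (h x)) /\ L2r D (fun x => complex.Im (h x)).

Definition L2v m (D : set R) (h : R -> 'cV[C]_m) : Prop :=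
  forall i : 'I_m, L2c D (fun x => h x i ord0).

Definition Cint (D : set R) (h : R -> C) : C :=
  Complex (Rintegral mu D (fun x => complex.Re (h x)))
          (Rintegral mu D (fun x => complex.Im (h x))).

Definition CVint m (D : set R) (h : R -> 'cV[C]_m) : 'cV[C]_m :=
  \col_i Cint D (fun x => h x i ord0).

Definition H1 m (a b : R) (g : R -> 'cV[C]_m) : Prop :=
  exists gd : R -> 'cV[C]_m, L2v `[a, b] gd /\
    forall t, a <= t <= b -> g t = g a + CVint `[a, t] gd.

Definition cmx p q (M : 'M[R]_(p, q)) : 'M[C]_(p, q) :=
  map_mx (fun x => (x%:C)%C) M.

Definition is_solution n r (Am1 : 'M[R]_n) (B : 'M[R]_(n, r))
  (A2 A3 : R -> 'M[C]_n) (T : R) (u : R -> 'cV[C]_r) (z : R -> 'cV[C]_n) : Prop :=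
  exists zd : R -> 'cV[C]_n,
    [/\ L2v `[-1, T] zd,
        (forall t, -1 <= t <= 0 -> z t = 0),
        (forall t, -1 <= t <= T -> z t = CVint `[-1, t] zd) &
        {ae mu, forall t, 0 <= t <= T ->
           zd t = cmx Am1 *m zd (t - 1)
                  + CVint `[-1, 0] (fun th => A2 th *m zd (t + th))
                  + CVint `[-1, 0] (fun th => A3 th *m z (t + th))
                  + cmx B *m u t}].

(* exact controllability at time T: the set of restrictions to [T-1,T] of
   solutions with zero initial data, over all controls u in L_2(0,T;C^r),
   equals H^1(T-1,T;C^n). Functions are compared via their restriction to
   [T-1,T] (both predicates only depend on the values on [T-1,T]). *)
Definition exactly_controllable n r (Am1 : 'M[R]_n) (B : 'M[R]_(n, r))
  (A2 A3 : R -> 'M[C]_n) (T : R) : Prop :=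
  [set g : R -> 'cV[C]_n | exists (u : R -> 'cV[C]_r) (z : R -> 'cV[C]_n),
      [/\ L2v `[0, T] u, is_solution Am1 B A2 A3 T u z &
          forall t, T - 1 <= t <= T -> g t = z t]]
  = [set g : R -> 'cV[C]_n | H1 (T - 1) T g].

End NeutralDefs.

(* Main.v *)
Require Import Defs.
From HB Require Import structures.
From mathcomp Require Import all_boot all_order all_algebra.
From mathcomp Require Import all_classical all_reals all_analysis.
From mathcomp Require Import complex measurable_realfun lra.

Set Implicit Arguments.
Unset Strict Implicit.
Unset Printing Implicit Defensive.

Import Order.TTheory GRing.Theory Num.Theory.
Import numFieldNormedType.Exports ComplexField.Normc.
Local Open Scope ring_scope.

(** If [(A_{-1}, B)] is not controllable, some nonzero row [w] satisfies
    [w A_{-1}^k B = 0] for every [k].  Multiplying the equation by [w] removes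
    the control: [w z'(t) = (w A_{-1}) z'(t - 1) + w f(t)], where the
    distributed delay terms [f] pair square integrable functions and are
    therefore bounded.  Since [z'] vanishes on [[-1, 0]] and [w A_{-1}] has the
    same property as [w], stepping back by unit intervals shows that [w z'] is
    essentially bounded on [[-1, T]].  But [H^1(T - 1, T)] contains functions
    [g] with [w g'] unbounded, such as the primitive of [q w^T] for any
    square integrable [q] that is not essentially bounded. *)

Lemma expmx_linear_combination (R : comNzRingType) (n : nat)
    (A : 'M[R]_n.+1) (k : nat) :
  exists a : 'I_n.+1 -> R, A ^+ k = \sum_i a i *: A ^+ i.
Proof.
pose q := Pdiv.CommonRing.rmodp 'X^k (char_poly A).
have size_q : (size q <= n.+1)%N.
  rewrite -ltnS -(size_char_poly A) Pdiv.CommonRing.ltn_rmodp.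
  exact/monic_neq0/char_poly_monic.
have AkE : A ^+ k = horner_mx A q.
  rewrite -{1}[A]horner_mx_X -rmorphXn /=.
  rewrite (Pdiv.RingMonic.rdivp_eq (char_poly_monic A) 'X^k).
  by rewrite rmorphD rmorphM /= Cayley_Hamilton mulr0 add0r.
exists (fun i => q`_i).
rewrite AkE -{1}(take_poly_id size_q) /take_poly poly_def rmorph_sum /=.
by apply: eq_bigr => i _; rewrite linearZ /= rmorphXn /= horner_mx_X.
Qed.

Section AnnihilatesReachable.
Context {R : comNzRingType} {n r m : nat}.
Implicit Types (A : 'M[R]_n) (B : 'M[R]_(n, r)) (W : 'M[R]_(m, n)).

Definition annihilates_reachable A B W : Prop :=
  forall k : nat, W *m A ^+ k *m B = 0.

Lemma annihilates_reachable_mul0 A B W :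
  annihilates_reachable A B W -> W *m B = 0.
Proof. by move=> /(_ 0); rewrite expr0 mulmx1. Qed.

Lemma annihilates_reachable_mulmx A B W :
  annihilates_reachable A B W -> annihilates_reachable A B (W *m A).
Proof. by move=> WAB k; rewrite -(mulmxA W) -[A *m _]exprS WAB. Qed.

End AnnihilatesReachable.

Lemma annihilates_reachable_ord (R : comNzRingType) (n r m : nat)
    (A : 'M[R]_n) (B : 'M[R]_(n, r)) (W : 'M[R]_(m, n)) :
  (forall k : 'I_n, W *m A ^+ k *m B = 0) -> annihilates_reachable A B W.
Proof.
case: n A B W => [|n] A B W WAB k; first by rewrite [W]thinmx0 !mul0mx.
have [a ->] := expmx_linear_combination A k.
rewrite mulmx_sumr mulmx_suml big1 // => i _.
by rewrite -scalemxAr -scalemxAl WAB scaler0.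
Qed.

Lemma uncontrollable_left_vector (F : fieldType) (n r : nat)
    (A : 'M[F]_n) (B : 'M[F]_(n, r)) :
  (\rank (\mxrow_(k < n) (A ^+ k *m B)) < n)%N ->
  exists2 w : 'rV[F]_n, w != 0 & annihilates_reachable A B w.
Proof.
set K := \mxrow_(k < n) _ => rankK.
have /rowV0Pn[w /sub_kermxP wK w0] : kermx K != 0.
  by rewrite kermx_eq0 /row_free neq_ltn rankK.
exists w => //; apply: annihilates_reachable_ord => k.
have := congr1 (fun M => submxrow M k) wK.
by rewrite mul_mxrow mxrowK submxrow0 mulmxA.
Qed.

Section MatrixNorm.
Context {R : realType}.

Lemma ler_mx_entry_norm (m n : nat) (A : 'M[R]_(m, n)) i j : `|A i j| <= `|A|.
Proof.
rewrite [leRHS]/Num.norm /= mx_normrE.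
exact: (le_bigmax _ (fun ij : 'I_m * 'I_n => `|A ij.1 ij.2|) (i, j)).
Qed.

Lemma mx_norm_le (m n : nat) (A : 'M[R]_(m, n)) (M : R) :
  0 <= M -> (forall i j, `|A i j| <= M) -> `|A| <= M.
Proof.
by move=> M0 AM; rewrite [leLHS]/Num.norm /= mx_normrE; exact: bigmax_le.
Qed.

Lemma ler_norm_mulmx (m n p : nat) (A : 'M[R]_(m, n)) (B : 'M[R]_(n, p)) :
  `|A *m B| <= n%:R * (`|A| * `|B|).
Proof.
apply: mx_norm_le => [|i j]; first by rewrite !mulr_ge0.
rewrite mxE (le_trans (ler_norm_sum _ _ _))// mulr_natl.
rewrite -[X in _ *+ X]card_ord -sumr_const ler_sum// => k _.
by rewrite normrM ler_pM// ler_mx_entry_norm.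
Qed.

End MatrixNorm.

Section EssentiallyBounded.
Local Open Scope classical_set_scope.
Context d (T : measurableType d) (R : realType).
Variable mu : {measure set T -> \bar R}.

Definition ess_bounded (V : normedZmodType R) (D : set T) (f : T -> V) : Prop :=
  exists M, {ae mu, forall t, D t -> `|f t| <= M}.

Lemma ess_bounded_sub (V : normedZmodType R) (D E : set T) (f : T -> V) :
  D `<=` E -> ess_bounded E f -> ess_bounded D f.
Proof.
by move=> DE [M fM]; exists M; apply: filterS fM => t fM /DE; exact: fM.
Qed.

Lemma ess_boundedU (V : normedZmodType R) (D E : set T) (f : T -> V) :
  ess_bounded D f -> ess_bounded E f -> ess_bounded (D `|` E) f.
Proof.
move=> [M fM] [N fN]; exists (Num.max M N).
apply: filterS2 fM fN => t fM fN; rewrite le_max => -[/fM ->//|/fN ->].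
by rewrite orbT.
Qed.

Lemma eq_ess_bounded (V : normedZmodType R) (D : set T) (f g : T -> V) :
  {ae mu, forall t, D t -> f t = g t} -> ess_bounded D g -> ess_bounded D f.
Proof.
move=> fg [M gM]; exists M.
by apply: filterS2 fg gM => t fg gM Dt; rewrite fg// gM.
Qed.

Lemma ess_boundedD (V : normedZmodType R) (D : set T) (f g : T -> V) :
  ess_bounded D f -> ess_bounded D g -> ess_bounded D (fun t => f t + g t).
Proof.
move=> [M fM] [N gN]; exists (M + N); apply: filterS2 fM gN => t fM gN Dt.
by rewrite (le_trans (ler_normD _ _))// lerD ?fM ?gN.
Qed.

Lemma ess_bounded_mulmx (m n p : nat) (D : set T) (W : 'M[R]_(m, n))
    (f : T -> 'M[R]_(n, p)) :
  ess_bounded D f -> ess_bounded D (fun t => W *m f t).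
Proof.
move=> [M fM]; exists (n%:R * (`|W| * M)); apply: filterS fM => t fM Dt.
by rewrite (le_trans (ler_norm_mulmx _ _))// !ler_wpM2l ?fM.
Qed.

Lemma ess_bounded_mx (m n : nat) (D : set T) (f : T -> 'M[R]_(m, n)) :
  (forall i j, ess_bounded D (fun t => f t i j)) -> ess_bounded D f.
Proof.
move=> entry_bounded.
have /choice[M fM] (ij : 'I_m * 'I_n) :
    exists M, {ae mu, forall t, D t -> `|f t ij.1 ij.2| <= M}.
  exact: entry_bounded.
exists (\big[Num.max/0]_ij M ij).
apply: filterS (filter_forall _ fM) => t {}fM Dt.
apply: mx_norm_le => [|i j]; first exact: bigmax_ge_id.
exact: le_trans (fM (i, j) Dt) (le_bigmax _ _ _).
Qed.

Lemma ess_bounded_scaler (V : normedModType R) (D : set T) (f : T -> R)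
    (v : V) :
  v != 0 -> ess_bounded D (fun t => f t *: v) -> ess_bounded D f.
Proof.
move=> v0 [M fvM]; exists (M / `|v|); apply: filterS fvM => t fvM Dt.
by rewrite ler_pdivlMr ?normr_gt0// -normrZ fvM.
Qed.

End EssentiallyBounded.

#[local] Instance lebesgue_ae_filter (R : realType) :
  Filter (nbhs (almost_everywhere (@lebesgue_measure R))).
Proof. exact: (ae_filter_ringOfSetsType (@lebesgue_measure R)). Qed.

Section Translation.
Local Open Scope classical_set_scope.
Context {R : realType}.
Local Notation mu := (@lebesgue_measure R).

Lemma measurable_translation (c : R) :
  measurable_fun [set: R] (fun x : R => x + c).
Proof. exact: measurable_funD. Qed.

Lemma measurable_preimage_translation (c : R) (D : set R) :
  measurable D -> measurable ((fun x => x + c) @^-1` D).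
Proof.
by move=> mD; rewrite -[X in measurable X]setTI; exact: measurable_translation.
Qed.

Lemma lebesgue_measure_translation (c : R) (D : set R) :
  measurable D -> mu ((fun x => x + c) @^-1` D) = mu D.
Proof.
move=> mD; apply/esym.
pose phi (x : measurableTypeR R) : measurableTypeR R := x + c.
have mphi : measurable_fun [set: measurableTypeR R] phi.
  exact: measurable_translation.
pose nu := (pushforward mu phi :
  {measure set (measurableTypeR R) -> \bar R}).
suff /(_ D mD) : forall E, measurable E -> mu E = nu mphi E by [].
apply: lebesgue_measure_unique => X /ocitvP[->|[[a b] /= ab ->]].
  by rewrite !measure0.
rewrite /nu /= /pushforward.
have -> : (fun x : R => x + c) @^-1` `]a, b] = `]a - c, b - c].
  by apply/seteqP; split => x /=; rewrite !in_itv/= ltrBlDr lerBrDr.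
rewrite -/mu !lebesgue_measure_itv/= !lte_fin ltrD2r ab -!EFinD.
by congr EFin; rewrite opprB addrA subrK.
Qed.

Lemma ae_translation (c : R) (P : R -> Prop) :
  {ae mu, forall t, P t} -> {ae mu, forall t, P (t + c)}.
Proof.
move=> [N [mN N0 PN]]; exists ((fun x => x + c) @^-1` N); split.
- exact: measurable_preimage_translation.
- by rewrite [LHS]lebesgue_measure_translation.
- by move=> x /= nP; exact: PN.
Qed.

Lemma ess_bounded_translation (V : normedZmodType R) (c : R) (D E : set R)
    (f : R -> V) :
  (forall t, D t -> E (t + c)) -> ess_bounded mu E f ->
  ess_bounded mu D (fun t => f (t + c)).
Proof.
move=> DE [M fM]; exists M.
by apply: filterS (ae_translation c fM) => t {}fM /DE; exact: fM.
Qed.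

Lemma ge0_integral_translation (c : R) (D : set R) (f : R -> \bar R) :
  measurable D -> measurable_fun D f -> (forall x, D x -> 0 <= f x)%E ->
  (\int[mu]_(x in (fun x => (x + c)%R) @^-1` D) f (x + c)%R =
   \int[mu]_(x in D) f x)%E.
Proof.
move=> mD mf f0; apply/esym.
have f_ge0 : {in D, forall y, (0 <= f y)%E} by move=> x /set_mem /f0.
apply: etrans (@ge0_integral_pushforward _ _ (measurableTypeR R)
  (measurableTypeR R) R _ (measurable_translation c) mu D f mD mf f_ge0).
apply: eq_measure_integral => [|mphi A mA _].
  exact: measurable_translation.
exact/esym/lebesgue_measure_translation.
Qed.

Lemma measurable_fun_translation (c : R) (D E : set R) d'
    (T : measurableType d') (f : R -> T) :
  measurable E -> (forall x, D x -> E (x + c)) ->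
  measurable_fun E f -> measurable_fun D (fun x => f (x + c)).
Proof.
move=> mE DE mf; apply: (measurable_comp mE) => //.
  by move=> _ [x Dx <-]; exact: DE.
exact: measurable_funS (measurable_translation c).
Qed.

Lemma ge0_integral_translation_le (c : R) (D E : set R) (f : R -> \bar R) :
  measurable D -> measurable E -> (forall x, D x -> E (x + c)) ->
  measurable_fun E f -> (forall x, E x -> 0 <= f x)%E ->
  (\int[mu]_(x in D) f (x + c)%R <= \int[mu]_(x in E) f x)%E.
Proof.
move=> mD mE DE mf f0; rewrite -(ge0_integral_translation c mE)//.
apply: ge0_subset_integral => //; first exact: measurable_preimage_translation.
- exact: measurable_fun_translation mf.
- by move=> x; exact: f0.
Qed.

End Translation.

Section DelayEquation.
Local Open Scope classical_set_scope.
Context {R : realType} {n r m : nat}.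
Local Notation mu := (@lebesgue_measure R).

Lemma delay_equation_ess_bounded (A : 'M[R]_n) (B : 'M[R]_(n, r))
    (W : 'M[R]_(m, n)) (x f : R -> 'cV[R]_n) (v : R -> 'cV[R]_r) (T : R) :
  annihilates_reachable A B W ->
  ess_bounded mu `[-1, 0] x ->
  ess_bounded mu `[0, T] f ->
  {ae mu, forall t, 0 <= t <= T ->
    x t = A *m x (t - 1) + f t + B *m v t} ->
  ess_bounded mu `[-1, T] (fun t => W *m x t).
Proof.
move=> WAB x_history.
have [k] : exists k : nat, T <= k%:R.
  by exists (Num.truncn T).+1; exact/ltW/truncnS_gt.
elim: k T W WAB => [|k IH] T W WAB Tk f_bounded eqn.
  apply: ess_bounded_mulmx; apply: ess_bounded_sub x_history => t /=.
  by rewrite !in_itv /= => /andP[-> /le_trans]; exact.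
have Wx_past : ess_bounded mu `[-1, T - 1] (fun t => W *m A *m x t).
  apply: IH; first exact: annihilates_reachable_mulmx.
  - by rewrite lerBlDr natr1.
  - by apply: ess_bounded_sub f_bounded => t /=; rewrite !in_itv /=; lra.
  - by apply: filterS eqn => t xE tT; apply: xE; lra.
suff : ess_bounded mu (`[-1, 0] `|` `[0, T]) (fun t => W *m x t).
  apply: ess_bounded_sub => t /=; rewrite !in_itv /= => tT.
  by case: (leP t 0) => t0; [left|right]; lra.
apply: ess_boundedU; first exact: ess_bounded_mulmx.
have Wx_present :
    ess_bounded mu `[0, T] (fun t => W *m A *m x (t - 1) + W *m f t).
  apply: ess_boundedD; last exact: ess_bounded_mulmx.
  by apply: ess_bounded_translation Wx_past => t /=; rewrite !in_itv /=; lra.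
apply: eq_ess_bounded Wx_present.
apply: filterS eqn => t xE; rewrite /= in_itv /= => /xE ->.
by rewrite !mulmxDr !mulmxA (annihilates_reachable_mul0 WAB) mul0mx addr0.
Qed.

End DelayEquation.

Lemma Rintegral_sum d (T : measurableType d) (R : realType)
    (mu : {measure set T -> \bar R}) (D : set T) (I : Type) (s : seq I)
    (P : pred I) (f : I -> T -> R) :
  measurable D -> (forall i, mu.-integrable D (EFin \o f i)) ->
  Rintegral mu D (fun x => \sum_(i <- s | P i) f i x) =
  \sum_(i <- s | P i) Rintegral mu D (f i).
Proof.
move=> mD intf; rewrite /Rintegral; under eq_integral do rewrite -sumEFin.
rewrite integral_sum// sum_fine// => i _.
exact: integrable_fin_num (intf i).
Qed.

Section SquareIntegrable.
Local Open Scope classical_set_scope.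
Context {R : realType}.
Local Notation mu := (@lebesgue_measure R).
Implicit Types (a b c : R) (D E : set R) (f g : R -> R).

Lemma measurable_EFin_sqr D f :
  measurable_fun D f -> measurable_fun D (fun x => (f x ^+ 2)%:E).
Proof. by move=> mf; apply/measurable_EFinP; exact: measurable_funX. Qed.

Lemma L2r_sqr_integrable D f :
  L2r D f -> mu.-integrable D (EFin \o (fun x => f x ^+ 2)).
Proof.
move=> [mf foo]; apply/integrableP; split; first exact: measurable_EFin_sqr.
by under eq_integral do rewrite /= ger0_norm ?sqr_ge0//.
Qed.

Lemma eq_L2r D f g : {in D, f =1 g} -> L2r D f -> L2r D g.
Proof.
move=> fg [mf foo]; split; first exact: eq_measurable_fun mf.
by under eq_integral => x Dx do rewrite -fg//.
Qed.

Lemma L2r_cst D k : measurable D -> (mu D < +oo)%E -> L2r D (fun=> k).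
Proof.
move=> mD Doo; split; first exact: measurable_cst.
by rewrite integral_cst// lte_mul_pinfty// lee_fin sqr_ge0.
Qed.

Lemma L2rZ D k f : measurable D -> L2r D f -> L2r D (fun x => k * f x).
Proof.
move=> mD [mf foo]; split; first exact: measurable_funM.
under eq_integral do rewrite exprMn EFinM.
rewrite ge0_integralZl ?lee_fin ?sqr_ge0//.
- by rewrite lte_mul_pinfty ?lee_fin ?sqr_ge0.
- exact: measurable_EFin_sqr.
- by move=> x _; rewrite lee_fin sqr_ge0.
Qed.

Lemma L2r_mul_integrable D f g : measurable D -> L2r D f -> L2r D g ->
  mu.-integrable D (EFin \o (fun x => f x * g x)).
Proof.
move=> mD L2f L2g.
have := integrableD (mu := mu) mD
  (L2r_sqr_integrable L2f) (L2r_sqr_integrable L2g).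
apply: le_integrable => //.
  apply/measurable_EFinP; apply: measurable_funM; first exact: L2f.1.
  exact: L2g.1.
move=> x _ /=; rewrite lee_fin [leRHS]ger0_norm ?addr_ge0 ?sqr_ge0// ler_norml.
have := sqr_ge0 (f x + g x); have := sqr_ge0 (f x - g x).
by have := sqr_ge0 (f x); have := sqr_ge0 (g x); nra.
Qed.

Lemma L2r_integrable D f : measurable D -> (mu D < +oo)%E -> L2r D f ->
  mu.-integrable D (EFin \o f).
Proof.
move=> mD Doo L2f; have := L2r_mul_integrable mD (L2r_cst 1 mD Doo) L2f.
by apply: eq_integrable => // x _ /=; rewrite mul1r.
Qed.

Lemma lebesgue_measure_itvcc_lty a b : (mu `[a, b] < +oo)%E.
Proof.
by rewrite lebesgue_measure_itv/=; case: ifP => _; rewrite -?EFinB ltry.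
Qed.

Lemma L2r_itvcc_integrable a b f :
  L2r `[a, b] f -> mu.-integrable `[a, b] (EFin \o f).
Proof. by apply: L2r_integrable => //; exact: lebesgue_measure_itvcc_lty. Qed.

Lemma L2r_subset D E (f : R -> R) : measurable D -> measurable E -> D `<=` E ->
  L2r E f -> L2r D f.
Proof.
move=> mD mE DE [mf foo]; split; first exact: measurable_funS mf.
apply: le_lt_trans foo; apply: ge0_subset_integral => //.
- exact: measurable_EFin_sqr.
- by move=> x _; rewrite lee_fin sqr_ge0.
Qed.

Lemma L2r_translation c D E f : measurable D -> measurable E ->
  (forall x, D x -> E (x + c)) -> L2r E f -> L2r D (fun x => f (x + c)).
Proof.
move=> mD mE DE [mf foo]; split; first exact: (measurable_fun_translation mE).
apply: le_lt_trans foo.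
apply: (@ge0_integral_translation_le _ c D E
  (fun x => (f x ^+ 2)%:E)) => //.
- exact: measurable_EFin_sqr.
- by move=> x _; rewrite lee_fin sqr_ge0.
Qed.

Lemma L2r_primitive a b f : a <= b -> L2r `[a, b] f ->
  L2r `[a, b] (fun t => Rintegral mu `[a, t] f).
Proof.
move=> ab /L2r_itvcc_integrable intf.
have cF := parameterized_integral_continuous ab intf.
split; first exact: subspace_continuous_measurable_fun.
have cF2 : {within `[a, b],
    continuous (fun t => (Rintegral mu `[a, t] f) ^+ 2)}.
  move=> x; apply: (@continuous_comp (subspace `[a, b]) R R
    (fun t => Rintegral mu `[a, t] f) (fun y => y ^+ 2)); first exact: cF.
  exact: exprn_continuous.
have /integrableP[_] :=
  continuous_compact_integrable (@segment_compact _ a b) cF2.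
by under eq_integral do rewrite /= ger0_norm ?sqr_ge0//.
Qed.

End SquareIntegrable.

Section RealPart.
Context {R : realType}.
Local Notation C := (complex R).

Definition Re_mx (m n : nat) (A : 'M[C]_(m, n)) : 'M[R]_(m, n) :=
  map_mx (@complex.Re R) A.

Lemma Re_mxD (m n : nat) (A B : 'M[C]_(m, n)) :
  Re_mx (A + B) = Re_mx A + Re_mx B.
Proof. by apply/matrixP => i j; rewrite !mxE raddfD. Qed.

Lemma Re_mx_cmx (m n : nat) (A : 'M[R]_(m, n)) : Re_mx (cmx A) = A.
Proof. by apply/matrixP => i j; rewrite !mxE. Qed.

Lemma Re_mx_cmx_mulmx (m n p : nat) (A : 'M[R]_(m, n)) (B : 'M[C]_(n, p)) :
  Re_mx (cmx A *m B) = A *m Re_mx B.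
Proof.
apply/matrixP => i j; rewrite !mxE raddf_sum; apply: eq_bigr => k _.
by rewrite !mxE /=; case: (B k j) => a b /=; rewrite mul0r subr0.
Qed.

End RealPart.

Section ComplexSquareIntegrable.
Local Open Scope classical_set_scope.
Context {R : realType}.
Local Notation C := (complex R).
Local Notation mu := (@lebesgue_measure R).
Implicit Types (c : R) (D E : set R) (h k : R -> C).

Lemma sqr_normcE (z : C) : normc z ^+ 2 = complex.Re z ^+ 2 + complex.Im z ^+ 2.
Proof. by case: z => a b; rewrite sqr_sqrtr// addr_ge0 ?sqr_ge0. Qed.

Lemma norm_Re_mul_le (z w : C) :
  `|complex.Re (z * w)| <= normc z ^+ 2 + normc w ^+ 2.
Proof.
rewrite !sqr_normcE; case: z => a b; case: w => c d /=; rewrite ler_norml.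
have := sqr_ge0 (a + c); have := sqr_ge0 (a - c).
have := sqr_ge0 (b + d); have := sqr_ge0 (b - d).
by move=> *; apply/andP; split; nra.
Qed.

Lemma L2c_sqr_normc_integrable D h : measurable D -> L2c D h ->
  mu.-integrable D (EFin \o (fun x => normc (h x) ^+ 2)).
Proof.
move=> mD [/L2r_sqr_integrable L2Re /L2r_sqr_integrable L2Im].
apply: eq_integrable (integrableD (mu := mu) mD L2Re L2Im) => // x _ /=.
by rewrite sqr_normcE EFinD.
Qed.

Lemma L2c_Re_mul_integrable D h k : measurable D -> L2c D h -> L2c D k ->
  mu.-integrable D (EFin \o (fun x => complex.Re (h x * k x))).
Proof.
move=> mD [hRe hIm] [kRe kIm].
apply: eq_integrable (integrableB (mu := mu) mD (L2r_mul_integrable mD hRe kRe)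
  (L2r_mul_integrable mD hIm kIm)) => // x _ /=.
by case: (h x) => a b; case: (k x).
Qed.

Lemma L2c_translation c D E h : measurable D -> measurable E ->
  (forall x, D x -> E (x + c)) -> L2c E h -> L2c D (fun x => h (x + c)).
Proof.
move=> mD mE DE [L2Re L2Im]; split.
- exact: (L2r_translation mD mE DE L2Re).
- exact: (L2r_translation mD mE DE L2Im).
Qed.

Lemma L2v_subset (m : nat) D E (f : R -> 'cV[C]_m) :
  measurable D -> measurable E -> D `<=` E -> L2v E f -> L2v D f.
Proof.
move=> mD mE DE L2f i; have [L2Re L2Im] := L2f i.
by split; [exact: L2r_subset L2Re|exact: L2r_subset L2Im].
Qed.

Lemma L2v_cst (m : nat) D (v : 'cV[C]_m) :
  measurable D -> (mu D < +oo)%E -> L2v D (fun=> v).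
Proof. by move=> mD Doo i; split; exact: L2r_cst. Qed.

Lemma L2v_cmx_scale (m : nat) D (q : R -> R) (v : 'cV[R]_m) :
  measurable D -> L2r D q -> L2v D (fun s => cmx (q s *: v)).
Proof.
move=> mD L2q i; split.
  by apply: eq_L2r (L2rZ (v i ord0) mD L2q) => s _; rewrite !mxE mulrC.
by apply: eq_L2r (L2rZ 0 mD L2q) => s _; rewrite !mxE mul0r.
Qed.

Lemma eq_L2v (m : nat) D (f g : R -> 'cV[C]_m) :
  {in D, f =1 g} -> L2v D f -> L2v D g.
Proof.
move=> fg L2f i; have [L2Re L2Im] := L2f i.
by split; [apply: eq_L2r L2Re|apply: eq_L2r L2Im] => x Dx /=; rewrite fg.
Qed.

Lemma L2v_primitive (m : nat) (a b : R) (f : R -> 'cV[C]_m) : a <= b ->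
  L2v `[a, b] f -> L2v `[a, b] (fun t => CVint `[a, t] f).
Proof.
move=> ab L2f i; have [L2Re L2Im] := L2f i.
by split; [apply: eq_L2r (L2r_primitive ab L2Re)
          |apply: eq_L2r (L2r_primitive ab L2Im)] => t _; rewrite mxE.
Qed.

End ComplexSquareIntegrable.

Section DelayTerm.
Local Open Scope classical_set_scope.
Context {R : realType}.
Local Notation C := (complex R).
Local Notation mu := (@lebesgue_measure R).

Lemma norm_Rintegral_Re_mul_translation_le (c : R) (D E : set R)
    (h k : R -> C) :
  measurable D -> measurable E -> (forall x, D x -> E (x + c)) ->
  L2c D h -> L2c E k ->
  `|Rintegral mu D (fun x => complex.Re (h x * k (x + c)))| <=
  Rintegral mu D (fun x => normc (h x) ^+ 2) +
  Rintegral mu E (fun x => normc (k x) ^+ 2).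
Proof.
move=> mD mE DE L2h L2k.
have L2kc := L2c_translation mD mE DE L2k.
have inthk := L2c_Re_mul_integrable mD L2h L2kc.
have inth2 := L2c_sqr_normc_integrable mD L2h.
have intk2 := L2c_sqr_normc_integrable mE L2k.
have intkc2 := L2c_sqr_normc_integrable mD L2kc.
apply: (@le_trans _ _ (Rintegral mu D
    (fun x => normc (h x) ^+ 2 + normc (k (x + c)) ^+ 2))).
  apply: le_trans (le_normr_Rintegral (mu := mu) mD inthk) _.
  apply: le_Rintegral => // [||x _]; last exact: norm_Re_mul_le.
  - exact: integrable_norm.
  - by apply: eq_integrable (integrableD (mu := mu) mD inth2 intkc2).
rewrite RintegralD// lerD2l fine_le ?integrable_fin_num//.
apply: (@ge0_integral_translation_le _ c D E
  (fun x => (normc (k x) ^+ 2)%:E)) => //.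
- exact: measurable_int intk2.
- by move=> x _; rewrite lee_fin sqr_ge0.
Qed.

Lemma ess_bounded_Re_delay_term (m n : nat) (D E I : set R)
    (K : R -> 'M[C]_(m, n)) (x : R -> 'cV[C]_n) :
  measurable D -> measurable E -> (forall t s, I t -> D s -> E (t + s)) ->
  (forall i j, L2c D (fun s => K s i j)) -> L2v E x ->
  ess_bounded mu I (fun t => Re_mx (CVint D (fun s => K s *m x (t + s)))).
Proof.
move=> mD mE IDE L2K L2x; apply: ess_bounded_mx => i j; rewrite {j}ord1.
exists (\sum_j (Rintegral mu D (fun s => normc (K s i j) ^+ 2) +
  Rintegral mu E (fun s => normc (x s j ord0) ^+ 2))).
apply: aeW => t It.
have DE s : D s -> E (s + t) by rewrite addrC; exact: IDE.
have intKx j : mu.-integrable D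
    (EFin \o (fun s => complex.Re (K s i j * x (s + t) j ord0))).
  apply: L2c_Re_mul_integrable => //.
  exact: (L2c_translation mD mE DE (L2x j)).
have -> : Re_mx (CVint D (fun s => K s *m x (t + s))) i ord0 =
    \sum_j Rintegral mu D (fun s => complex.Re (K s i j * x (s + t) j ord0)).
  rewrite -Rintegral_sum// !mxE /=; apply: eq_Rintegral => s _.
  by rewrite addrC mxE raddf_sum.
apply: le_trans (ler_norm_sum _ _ _) _; apply: ler_sum => j _.
exact: (@norm_Rintegral_Re_mul_translation_le t D E (fun s => K s i j)
  (fun s => x s j ord0)).
Qed.

End DelayTerm.

Section Primitives.
Local Open Scope classical_set_scope.
Context {R : realType}.
Local Notation C := (complex R).
Local Notation mu := (@lebesgue_measure R).

Lemma ae_neq (c : R) : {ae mu, forall t, t != c}.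
Proof.
exists [set c]; split => //; first by rewrite lebesgue_measure_set1.
by move=> t /= /negP; rewrite negbK => /eqP.
Qed.

Lemma ae_derive_primitive (a b : R) (f : R -> R) :
  mu.-integrable `[a, b] (EFin \o f) ->
  {ae mu, forall t, a < t < b ->
    is_derive t 1 (fun y => Rintegral mu `[a, y] f) (f t)}.
Proof.
move=> intf; have mab : measurable `[a, b] by [].
have intg : mu.-integrable setT (EFin \o (f \_ `[a, b])).
  by move: (intf); rewrite integrable_mkcond//= (restrict_EFin f).
have intgS y : mu.-integrable `[a, y] (EFin \o (f \_ `[a, b])).
  exact: integrableS intg.
have := @FTC1 _ (f \_ `[a, b]) (BLeft a) intgS (integrable_locally mab intf).
set F := fun y => _; apply: filterS => t dF /andP[t_gt_a t_lt_b].
have {dF}[] : derivable F t 1 /\ F^`() t = (f \_ `[a, b]) t.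
  by apply: dF; rewrite /= lte_fin.
rewrite derive1E => dF DF.
have FE : \near t, F t = Rintegral mu `[a, t] f.
  near=> y; rewrite /F; apply: eq_Rintegral => x /set_mem/=; rewrite in_itv/=.
  move=> /andP[ax xy]; rewrite patchE ifT// inE/= in_itv/= ax/= (le_trans xy)//.
  by apply/ltW; near: y; exact: lt_nbhsl.
have -> : f t = (f \_ `[a, b]) t.
  by rewrite patchE ifT// inE/= in_itv/= !ltW.
apply: DeriveDef; first exact: near_eq_derivable FE dF.
by rewrite -DF; apply/esym/near_eq_derive.
Unshelve. all: by end_near. Qed.

Lemma ae_eq_of_primitive (a0 a b k : R) (f g : R -> R) : a0 <= a ->
  mu.-integrable `[a0, b] (EFin \o f) -> mu.-integrable `[a, b] (EFin \o g) ->
  (forall t, a <= t <= b ->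
     Rintegral mu `[a0, t] f = k + Rintegral mu `[a, t] g) ->
  {ae mu, forall t, a <= t <= b -> f t = g t}.
Proof.
move=> a0a /ae_derive_primitive df /ae_derive_primitive dg fg.
apply: filterS2 (filterI df dg) (filterI (ae_neq a) (ae_neq b)).
move=> t [{}df {}dg] [t_neq_a t_neq_b] /andP[t_gt_a t_lt_b].
have {}t_gt_a : a < t by rewrite lt_neqAle eq_sym t_neq_a.
have {}t_lt_b : t < b by rewrite lt_neqAle t_neq_b.
have {}df := df (introT andP (conj (le_lt_trans a0a t_gt_a) t_lt_b)).
have {}dg := dg (introT andP (conj t_gt_a t_lt_b)).
have primE : \near t, Rintegral mu `[a0, t] f = k + Rintegral mu `[a, t] g.
  near=> y; apply: fg; apply/andP; split; apply/ltW.
    by near: y; exact: lt_nbhsr.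
  by near: y; exact: lt_nbhsl.
have dkg : is_derive t 1 (fun y => k + Rintegral mu `[a, y] g) (0 + g t).
  exact: is_deriveD.
rewrite -[RHS]add0r -(@derive_val _ _ _ _ _ _ _ df).
rewrite -(@derive_val _ _ _ _ _ _ _ dkg).
exact: near_eq_derive.
Unshelve. all: by end_near. Qed.

Lemma ae_eq_of_Cint_primitive (a0 a b : R) (k : C) (f g : R -> C) : a0 <= a ->
  L2c `[a0, b] f -> L2c `[a, b] g ->
  (forall t, a <= t <= b -> Cint `[a0, t] f = k + Cint `[a, t] g) ->
  {ae mu, forall t, a <= t <= b -> f t = g t}.
Proof.
move=> a0a [/L2r_itvcc_integrable fRe /L2r_itvcc_integrable fIm].
move=> [/L2r_itvcc_integrable gRe /L2r_itvcc_integrable gIm] fg.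
have ReE := @ae_eq_of_primitive a0 a b (complex.Re k) _ _ a0a fRe gRe.
have ImE := @ae_eq_of_primitive a0 a b (complex.Im k) _ _ a0a fIm gIm.
apply: filterS2 (ReE _) (ImE _) => t.
- move=> {}ReE {}ImE tab; apply/eqP.
  by rewrite eq_complex ReE// ImE// !eqxx.
- by move=> /fg /(congr1 (@complex.Re R)) /= ->; case: (k).
- by move=> /fg /(congr1 (@complex.Im R)) /= ->; case: (k).
Qed.

Lemma ae_eq_of_CVint_primitive (m : nat) (a0 a b : R) (k : 'cV[C]_m)
    (f g : R -> 'cV[C]_m) : a0 <= a ->
  L2v `[a0, b] f -> L2v `[a, b] g ->
  (forall t, a <= t <= b -> CVint `[a0, t] f = k + CVint `[a, t] g) ->
  {ae mu, forall t, a <= t <= b -> f t = g t}.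
Proof.
move=> a0a L2f L2g fg.
have coordE i t : a <= t <= b -> Cint `[a0, t] (fun s => f s i ord0) =
    k i ord0 + Cint `[a, t] (fun s => g s i ord0).
  by move=> /fg /(congr1 (fun v : 'cV_m => v i ord0)); rewrite !mxE.
have ae_coordE i : {ae mu, forall t, a <= t <= b -> f t i ord0 = g t i ord0}.
  exact: ae_eq_of_Cint_primitive (L2f i) (L2g i) (coordE i).
apply: filterS (filter_forall _ ae_coordE) => t {}ae_coordE tab.
by apply/colP => i; exact: ae_coordE.
Qed.

Lemma CVint0 (m : nat) (D : set R) : CVint D (fun=> 0 : 'cV[C]_m) = 0.
Proof.
apply/colP => i; rewrite !mxE.
by congr Complex; rewrite /Rintegral integral0_eq// => s _; rewrite mxE.
Qed.

Lemma CVint_set1 (m : nat) (a : R) (f : R -> 'cV[C]_m) : CVint `[a, a] f = 0.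
Proof.
by apply/matrixP => i j; rewrite set_itv1 !mxE /Cint !Rintegral_set1.
Qed.

Lemma H1_primitive (m : nat) (a b : R) (f : R -> 'cV[C]_m) :
  L2v `[a, b] f -> H1 a b (fun t => CVint `[a, t] f).
Proof. by exists f; split => // t _; rewrite CVint_set1 add0r. Qed.

End Primitives.

Section UnboundedSquareIntegrable.
Local Open Scope classical_set_scope.
Context {R : realType}.
Local Notation mu := (@lebesgue_measure R).

Lemma integral_powR (a b r : R) : 0 < a < b -> r != -1 ->
  (\int[mu]_(x in `[a, b]) (x `^ r)%:E =
   ((b `^ (r + 1) - a `^ (r + 1)) / (r + 1))%:E)%E.
Proof.
move=> /andP[a0 ab] rN1; have r1 : r + 1 != 0 by rewrite addr_eq0.
have dpowR s x : 0 < x -> derivable (fun y : R => y `^ s) x 1.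
  by move=> x0; apply: derivable_powR; rewrite in_itv/= x0.
have cpowR s x : 0 < x -> {for x, continuous (fun y : R => y `^ s)}.
  move=> x0.
  by apply: differentiable_continuous; apply/derivable1_diffP; exact: dpowR.
rewrite (@continuous_FTC2 _ _ (fun x => (r + 1)^-1 * x `^ (r + 1)) _ _ ab).
- by rewrite -EFinB -mulrBr mulrC.
- apply: continuous_in_subspaceT => x /set_mem/=; rewrite in_itv/=.
  by move=> /andP[ax _]; apply: cpowR; exact: lt_le_trans ax.
- split.
  + move=> x; rewrite in_itv/= => /andP[ax _].
    by apply: derivableM => //; apply: dpowR; exact: lt_trans ax.
  + apply: cvg_at_right_filter; apply: cvgM; first exact: cvg_cst.
    exact: cpowR.
  + apply: cvg_at_left_filter; apply: cvgM; first exact: cvg_cst.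
    by apply: cpowR; exact: lt_trans ab.
- move=> x; rewrite in_itv/= => /andP[ax _].
  have x0 : 0 < x by exact: lt_trans ax.
  rewrite derive1E deriveZ/=; last exact: dpowR.
  rewrite -derive1E powR_derive1 ?in_itv/= ?x0//.
  by rewrite /GRing.scale/= mulKf// addrK.
Qed.

Lemma ge0_integral_itvcc_le (a b : R) (f : R -> \bar R) (M : \bar R) :
  a < b -> measurable_fun `]a, b] f -> (forall x, a < x <= b -> (0 <= f x)%E) ->
  (forall e, a < e < b -> (\int[mu]_(x in `[e, b]) f x <= M)%E) ->
  (\int[mu]_(x in `[a, b]) f x <= M)%E.
Proof.
move=> ab mf f0 fM; rewrite -integral_itv_obnd_cbnd// itv_open_bnd_bigcup.
pose I k : set R := `[a + k.+1%:R^-1, b].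
have aI k : a < a + k.+1%:R^-1 by rewrite ltrDl invr_gt0.
have subI k : I k `<=` `]a, b].
  move=> x; rewrite /I/= !in_itv/= => /andP[+ ->]; rewrite andbT.
  exact: lt_le_trans.
have cvgI : (\int[mu]_(x in I k) f x)%E @[k --> \oo] -->
    (\int[mu]_(x in \bigcup_k I k) f x)%E.
  apply: ge0_nondecreasing_set_cvg_integral.
  - move=> k l kl; apply/subsetPset; apply: subset_itvr.
    by rewrite bnd_simp lerD2l lef_pV2 ?posrE// ler_nat.
  - by move=> k; exact: measurable_itv.
  - by move=> k; exact: measurable_funS mf.
  - by move=> k x /subI; rewrite /= in_itv/=; exact: f0.
rewrite -(cvg_lim _ cvgI)//.
apply: lime_le; first by apply/cvg_ex; eexists; exact: cvgI.
near=> k; apply: fM; rewrite aI/= -ltrBrDl; near: k.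
by apply: near_infty_natSinv_lt (PosNum _); rewrite subr_gt0.
Unshelve. all: by end_near. Qed.

Lemma L2r_powR (b r : R) : 0 < b -> - 2^-1 < r ->
  L2r `[0, b] (fun x : R => x `^ r).
Proof.
move=> b0 r2; split; first exact: measurable_funTS (measurable_powR _).
have p0 : 0 < r * 2 + 1 by lra.
apply: (@le_lt_trans _ _ (b `^ (r * 2 + 1) / (r * 2 + 1))%:E); last exact: ltry.
apply: ge0_integral_itvcc_le => // [|x _|e e0b].
- by apply: measurable_EFin_sqr; exact: measurable_funTS (measurable_powR _).
- by rewrite lee_fin sqr_ge0.
under eq_integral do rewrite -powR_mulrn ?powR_ge0// -powRrM.
rewrite integral_powR//; last by rewrite gt_eqF//; lra.
by rewrite lee_fin ler_pM2r ?invr_gt0// gerBl powR_ge0.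
Qed.

Lemma ae_near_right (a : R) (P Q : R -> Prop) :
  {ae mu, forall t, P t} -> (\forall t \near a^'+, Q t) -> exists t, P t /\ Q t.
Proof.
move=> [N [mN N0 PN]] [e /= e0 Qe]; apply: contrapT => nPQ.
have : (mu `]a, (a + e)%R[ <= mu N)%E.
  apply: le_measure; rewrite ?inE// => t /=; rewrite in_itv/=.
  move=> /andP[t_gt_a t_lt].
  apply: PN => Pt; apply: nPQ; exists t; split => //; apply: Qe => //=.
  by rewrite ltr0_norm ?subr_lt0// opprB ltrBlDl.
rewrite N0 lebesgue_measure_itv/= lte_fin ltrDl e0 -EFinB lee_fin.
by apply/negP; rewrite -ltNge addrAC subrr add0r.
Qed.

Lemma powRN_not_ess_bounded (b r : R) : 0 < b -> r < 0 ->
  ~ ess_bounded mu `[0, b] (fun x : R => x `^ r).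
Proof.
move=> b0 r0 [M powR_le].
have K0 : 0 < `|M| + 1 by rewrite ltr_wpDl.
have powR_gt : \forall t \near 0^'+, [/\ 0 < t, t < b & M < t `^ r].
  have powRN_lt : \forall t \near 0^'+, t `^ (- r) < (`|M| + 1)^-1.
    by apply: cvgr_lt (powR_cvg0 _) _ _; rewrite ?oppr_gt0// invr_gt0.
  near=> t; have t0 : 0 < t by near: t; exact: nbhs_right_gt.
  split => //.
  have : t `^ (- r) < (`|M| + 1)^-1 by near: t.
  rewrite powRN ltf_pV2 ?posrE ?powR_gt0//; apply: le_lt_trans.
  by rewrite (le_trans (ler_norm M))// lerDl.
have [t [tM [t0 tb]]] := ae_near_right powR_le powR_gt.
apply/negP; rewrite -leNgt (le_trans (ler_norm _))// tM//=.
by rewrite in_itv/= !ltW.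
Unshelve. all: by end_near. Qed.

Lemma exists_L2r_not_ess_bounded (a b : R) : a < b ->
  exists2 q : R -> R, L2r `[a, b] q & ~ ess_bounded mu `[a, b] q.
Proof.
move=> ab; pose p (x : R) := x `^ (- 4^-1).
exists (fun s => p (s + - a)).
  apply: (@L2r_translation _ (- a) _ `[0, b - a]) => //.
    by move=> s; rewrite /= !in_itv/= subr_ge0 lerD2r.
  by apply: L2r_powR; lra.
move=> q_bounded; apply: (@powRN_not_ess_bounded (b - a) (- 4^-1)); [lra|lra|].
have -> : (fun x : R => x `^ (- 4^-1)) = (fun x => p (x + a + - a)).
  by apply/funext => x; rewrite addrK.
apply: ess_bounded_translation q_bounded => x /=.
by rewrite !in_itv/= lerDr lerBrDr.
Qed.

End UnboundedSquareIntegrable.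

Lemma row_mul_tr_neq0 (R : realDomainType) (n : nat) (w : 'rV[R]_n) :
  w != 0 -> w *m w^T != 0.
Proof.
move=> /rV0Pn[j wj]; apply/eqP => /matrixP /(_ ord0 ord0).
rewrite !mxE => /eqP; rewrite psumr_eq0 => [/allP/(_ j)|i _].
  by rewrite mem_index_enum mxE -expr2 sqrf_eq0 (negPf wj) => /(_ isT).
by rewrite mxE -expr2 sqr_ge0.
Qed.

Section Solutions.
Local Open Scope classical_set_scope.
Context {R : realType} (n r : nat).
Local Notation C := (complex R).
Local Notation mu := (@lebesgue_measure R).
Variables (Am1 : 'M[R]_n) (B : 'M[R]_(n, r)) (A2 A3 : R -> 'M[C]_n).
Hypothesis L2A2 : forall i j, L2c `[-1, 0] (fun th => A2 th i j).
Hypothesis L2A3 : forall i j, L2c `[-1, 0] (fun th => A3 th i j).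

Lemma solution_derivative_projection_ess_bounded (T : R) (u : R -> 'cV[C]_r)
    (z : R -> 'cV[C]_n) :
  0 <= T -> is_solution Am1 B A2 A3 T u z ->
  exists zd : R -> 'cV[C]_n, [/\ L2v `[-1, T] zd,
    forall t, -1 <= t <= T -> z t = CVint `[-1, t] zd &
    forall m (W : 'M[R]_(m, n)), annihilates_reachable Am1 B W ->
      ess_bounded mu `[-1, T] (fun t => W *m Re_mx (zd t))].
Proof.
move=> T0 [zd [L2zd z0 zE eqn]]; exists zd; split => // m W WAB.
have delay_in t s : `[0, T] t -> `[-1, 0] s -> `[-1, T] (t + s).
  by rewrite /= !in_itv /=; lra.
have L2z : L2v `[-1, T] z.
  have N1T : -1 <= T by lra.
  apply: eq_L2v (L2v_primitive N1T L2zd) => t /set_mem /=.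
  by rewrite in_itv/= => /zE.
have zd_history : {ae mu, forall t, -1 <= t <= 0 -> zd t = 0}.
  apply: (@ae_eq_of_CVint_primitive _ _ (-1) (-1) 0 0 zd (fun=> 0)) => //.
  - apply: L2v_subset L2zd => //; apply: subset_itvl.
    by rewrite bnd_simp.
  - by apply: L2v_cst => //; exact: lebesgue_measure_itvcc_lty.
  - by move=> t t10; rewrite CVint0 addr0 -zE ?z0//; lra.
pose f t := Re_mx (CVint `[-1, 0] (fun th => A2 th *m zd (t + th))) +
  Re_mx (CVint `[-1, 0] (fun th => A3 th *m z (t + th))).
apply: (delay_equation_ess_bounded (f := f) (v := fun t => Re_mx (u t)) WAB).
- exists 0; apply: filterS zd_history => t zd0; rewrite /= in_itv/= => /zd0 ->.
  by rewrite (_ : Re_mx 0 = 0) ?normr0//; apply/matrixP => i j; rewrite !mxE.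
- by apply: ess_boundedD; apply: (ess_bounded_Re_delay_term (E := `[-1, T])).
- apply: filterS eqn => t zdE /zdE ->.
  by rewrite !Re_mxD !Re_mx_cmx_mulmx /f !addrA.
Qed.

End Solutions.

Theorem theorem3 (R : realType) (n r : nat) (hn : (0 < n)%N) (hr : (0 < r)%N)
  (Am1 : 'M[R]_n) (B : 'M[R]_(n, r)) (A2 A3 : R -> 'M[complex R]_n)
  (hA2 : forall i j, L2c `[-1, 0] (fun th => A2 th i j))
  (hA3 : forall i j, L2c `[-1, 0] (fun th => A3 th i j))
  (hnotctrl : (\rank (\mxrow_(k < n) (Am1 ^+ k *m B)) < n)%N) :
  forall T : R, 0 < T -> ~ exactly_controllable Am1 B A2 A3 T.
Proof.
move=> T T0 controllable.
have [w w0 wAB] := uncontrollable_left_vector hnotctrl.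
have T1T : T - 1 < T by lra.
have [q L2q q_unbounded] := exists_L2r_not_ess_bounded T1T.
pose gd s := cmx (q s *: w^T).
have L2gd : L2v `[T - 1, T] gd by exact: L2v_cmx_scale.
have : H1 (T - 1) T (fun t => CVint `[T - 1, t] gd) by exact: H1_primitive.
rewrite -[H1 _ _ _]/([set g | H1 (T - 1) T g]%classic _) -controllable.
move=> [u [z [_ z_sol gz]]].
have [zd [L2zd zE wzd_bounded]] :=
  solution_derivative_projection_ess_bounded hA2 hA3 (ltW T0) z_sol.
have zdE : {ae (@lebesgue_measure R), forall t, T - 1 <= t <= T -> zd t = gd t}.
  apply: (@ae_eq_of_CVint_primitive _ _ (-1) (T - 1) T 0) => //; first by lra.
  by move=> t tT; rewrite add0r gz// zE//; lra.
apply/q_unbounded/(ess_bounded_scaler (row_mul_tr_neq0 w0)).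
apply: eq_ess_bounded (ess_bounded_sub _ (wzd_bounded _ w wAB)).
  apply: filterS zdE => t zdE; rewrite /= in_itv/= => /zdE ->.
  by rewrite Re_mx_cmx scalemxAr.
by move=> t /=; rewrite !in_itv/=; lra.
Qed.
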